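(* Let $p$ be an odd prime, $n\ge1$, $i\ge1$. Assume $B=R_{n,i}^{\,p}\ne 0$ and set $$S_i:=D_n[Q_{n,0}^{-1},B^{-1}],\qquad \partial_i:=B^{-1}\delta_i .$$ Then $\partial_i^p=\partial_i$ as an $\mathbb{F}_p$-linear derivation of $S_i$. For $\lambda\in\mathbb{F}_p$ define $S_i^{(\lambda)}:=\ker(\partial_i-\lambda\,\mathrm{id}_{S_i})$. There is a direct-sum decomposition $$S_i=\bigoplus_{\lambda\in\mathbb{F}_p}S_i^{(\lambda)},$$ and the projection onto $S_i^{(\lambda)}$ is the Lagrange polynomial in $\partial_i$ $$\pi_\lambda=\prod_{\substack{\mu\in\mathbb{F}_p\\ \mu\neq\lambda}}\frac{\partial_i-\mu\,\mathrm{id}_{S_i}}{\lambda-\mu}.$$ The decomposition is multiplicative: $S_i^{(\lambda)}S_i^{(\mu)}\subseteq S_i^{(\lambda+\mu)}$ for $\lambda,\mu\in\mathbb{F}_p$, the sum of weights being taken in $\mathbb{F}_p$. In particular, $Q_{n,0}\in S_i^{(1)}$, $B\in S_i^{(0)}$, and $I_s\in S_i^{(0)}$ for $1\le s<n$. For $f\in S_i^{(\lambda)}$ and $m\ge 1$ one has $$(\mathrm{St}^{\Delta_i})^m(f)=(-1)^{mn}B^mQ_{n,0}^{\,m}\left(\prod_{r=0}^{m-1}(\lambda+r)\right)f,$$ with every factor $\lambda+r$ interpreted in $\mathbb{F}_p$. Consequently, as $\mathbb{F}_p$-vector spaces (all operators being regarded on $S_i$), $$\ker(\delta_i)=S_i^{(0)},\qquad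 \mathrm{Im}(\delta_i)=\bigoplus_{\lambda\in\mathbb{F}_p^\times}S_i^{(\lambda)},$$ and $$\ker(\mathrm{St}^{\Delta_i})=S_i^{(0)},\qquad \mathrm{Im}(\mathrm{St}^{\Delta_i})=\bigoplus_{\lambda\in\mathbb{F}_p\setminus\{1\}}S_i^{(\lambda)}.$$
   Context: Let $p$ be an odd prime, $n\ge 1$, $i\ge 1$, and $P_n=\mathbb{F}_p[x_1,\dots,x_n]$. For integers $e_1,\dots,e_n\ge 0$ put $[e_1,\dots,e_n]:=\det\big(x_r^{p^{e_s}}\big)_{1\le r,s\le n}\in P_n$. Let $L_n=[0,1,\dots,n-1]$ and $L_{n,s}=[0,1,\dots,\widehat{s},\dots,n]$ for $0\le s<n$ (a hat means omission). The Dickson invariants are $Q_{n,s}=L_{n,s}/L_n$ $(0\le s<n)$; in particular $Q_{n,0}=L_n^{p-1}$. The Dickson algebra is $D_n=P_n^{\mathrm{GL}_n(\mathbb{F}_p)}=\mathbb{F}_p[Q_{n,0},\dots,Q_{n,n-1}]$, a polynomial algebra on these generators. $\mathrm{St}^{\Delta_i}$ denotes the Steenrod--Milnor operation dual to the monomial $\xi_i$ in Milnor's dual mod-$p$ Steenrod algebra. It acts on $P_n$ as the unique $\mathbb{F}_p$-linear derivation with $\mathrm{St}^{\Delta_i}(x_r)=x_r^{p^i}$ $(1\le r\le n)$, and it maps $D_n$ into $D_n$. On a localization of $D_n$, $\mathrm{St}^{\Delta_i}$ means the unique derivation extending $\mathrm{St}^{\Delta_i}|_{D_n}$. Set $P_{n,i,0}:=0$,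 $P_{n,i,s}:=-\dfrac{[0,1,\dots,\widehat{s-1},\dots,n-1,i-1]}{L_n}$ for $0<s<n$, and $R_{n,i}:=\dfrac{[0,1,\dots,n-2,i-1]}{L_n}$ (for $n=1$, $R_{1,i}=[i-1]/L_1$). These quotients lie in $D_n$. Put $A_s:=P_{n,i,s}^{\,p}$, $B:=R_{n,i}^{\,p}$. The normalized derivation is $\delta_i:=(-1)^nQ_{n,0}^{-1}\mathrm{St}^{\Delta_i}$ on $D_n[Q_{n,0}^{-1}]$, extended uniquely as a derivation to further localizations. When $B\ne0$, the invariant ratios are $I_s:=\dfrac{Q_{n,s}+B^{-1}A_s}{Q_{n,0}}\in D_n[Q_{n,0}^{-1},B^{-1}]$. Powers of operators denote iterated composition. *)

(* Defs.v *)
From HB Require Import structures.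
From mathcomp Require Import all_boot all_order all_algebra.
From mathcomp Require Import fraction mpoly.
From mathcomp Require Import boolp classical_sets.
From mathcomp Require Import ring.

Set Implicit Arguments.
Unset Strict Implicit.
Unset Printing Implicit Defensive.

Import GRing.Theory.
Local Open Scope ring_scope.
Local Open Scope classical_set_scope.

Notation "x %:F" := (@FracField.tofrac _ x) : ring_scope.

(* The scalar action of R on rational functions is multiplication by the
   corresponding constant function. *)
Section FracMpolyAlgebra.
Variables (R : idomainType) (n : nat).
Local Notation K := {fraction {mpoly R[n]}}.

Definition frac_scale (c : R) (f : K) : K := (c%:MP)%:F * f.

Fact frac_scaleA a b v : frac_scale a (frac_scale b v) = frac_scale (a * b) v.
Proof. by rewrite /frac_scale mulrA -rmorphM -mpolyCM. Qed.

Fact frac_scale1 : left_id 1 frac_scale.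
Proof. by move=> v; rewrite /frac_scale mpolyC1 rmorph1 mul1r. Qed.

Fact frac_scaleDr : right_distributive frac_scale +%R.
Proof. by move=> a u v; rewrite /frac_scale mulrDr. Qed.

Fact frac_scaleDl v : {morph frac_scale^~ v : a b / a + b}.
Proof. by move=> a b; rewrite /frac_scale mpolyCD rmorphD mulrDl. Qed.

HB.instance Definition _ := GRing.Zmodule_isLmodule.Build R K
  frac_scaleA frac_scale1 frac_scaleDr frac_scaleDl.

Fact frac_scaleAl (c : R) (u v : K) : c *: (u * v) = (c *: u) * v.
Proof. exact: mulrA. Qed.

HB.instance Definition _ := GRing.Lmodule_isLalgebra.Build R K frac_scaleAl.
HB.instance Definition _ := GRing.Lalgebra_isComAlgebra.Build R K.

Lemma frac_scaleE (c : R) (f : K) : c *: f = (c%:MP)%:F * f.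
Proof. by []. Qed.

Lemma tofracZ (c : R) (f : {mpoly R[n]}) : (c *: f)%:F = c *: f%:F :> K.
Proof. by rewrite frac_scaleE -rmorphM mul_mpolyC. Qed.

End FracMpolyAlgebra.

Section QuotientIdentities.
Variables (F : fieldType) (a b a' b' da db da' db' : F).
Hypotheses (nzb : b != 0) (nzb' : b' != 0).

Lemma quotient_rule_repr (x : F) (da1 := (da * b' + x * b * db' - x * b' * db) / b) :
  (da1 * b' - x * b' * db') / b' ^+ 2 = (da * b - x * b * db) / b ^+ 2.
Proof. by rewrite /da1; field; apply/andP. Qed.

Lemma quotient_ruleM :
  ((da * a' + a * da') * (b * b') - a * a' * (db * b' + b * db')) / (b * b') ^+ 2
  = (da * b - a * db) / b ^+ 2 * (a' / b')
    + a / b * ((da' * b' - a' * db') / b' ^+ 2).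
Proof. by field; apply/andP. Qed.

Lemma quotient_ruleD :
  ((da * b' + a * db' + (da' * b + a' * db)) * (b * b')
    - (a * b' + a' * b) * (db * b' + b * db')) / (b * b') ^+ 2
  = (da * b - a * db) / b ^+ 2 + (da' * b' - a' * db') / b' ^+ 2.
Proof. by field; apply/andP. Qed.

End QuotientIdentities.

Section QuotientRule.
Variables (A : idomainType) (d : A -> A).

Definition frac_der (f : {fraction A}) : {fraction A} :=
  let a := \n_(repr f) in let b := \d_(repr f) in
  (d a * b - a * d b)%:F / (b ^+ 2)%:F.

Lemma frac_repr (f : {fraction A}) :
  f = (\n_(repr f))%:F / (\d_(repr f))%:F.
Proof.
rewrite -[LHS]reprK; case: (repr f) => [[a b] /= nzb]; unlock FracField.tofrac.
rewrite -[_^-1]FracField.pi_inv -[RHS]FracField.pi_mul.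
apply/eqP; rewrite FracField.equivf_def /FracField.mulf /FracField.invf /=.
by rewrite !numden_Ratio ?mul1r ?mulr1 ?oner_neq0 // mulrC.
Qed.

Hypothesis dD : {morph d : a b / a + b}.
Hypothesis dM : forall a b, d (a * b) = d a * b + a * d b.

Lemma frac_der_div (a b : A) : b != 0 ->
  frac_der (a%:F / b%:F) = (d a * b - a * d b)%:F / (b ^+ 2)%:F.
Proof.
move=> nzb; rewrite /frac_der; set x := a%:F / b%:F.
have nzb' := denom_ratioP (repr x); have := frac_repr x.
move: (\n_(repr x)) (\d_(repr x)) nzb' => a' b' nzb' xE'.
have Fb : b%:F != 0 :> {fraction A} by rewrite tofrac_eq0.
have Fb' : b'%:F != 0 :> {fraction A} by rewrite tofrac_eq0.
have aE : a%:F = x * b%:F by rewrite /x divfK.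
have a'E : a'%:F = x * b'%:F by rewrite xE' divfK.
have ab'E : a' * b = a * b'.
  by apply/eqP; rewrite -tofrac_eq !rmorphM /= aE a'E mulrAC.
have dab'E : (d a')%:F =
    ((d a)%:F * b'%:F + a%:F * (d b')%:F - a'%:F * (d b)%:F) / b%:F.
  apply: (canRL (mulfK Fb)); rewrite -!rmorphM -rmorphD -rmorphB -dM -ab'E dM.
  by rewrite addrK.
rewrite !rmorphXn !rmorphB !rmorphM /= dab'E aE a'E.
exact: quotient_rule_repr.
Qed.

Lemma frac_der_tofrac (a : A) : frac_der a%:F = (d a)%:F.
Proof.
have d1 : d 1 = 0.
  have := dM 1 1; rewrite !mulr1 mul1r => /eqP.
  by rewrite -subr_eq0 opprD addrA subrr sub0r oppr_eq0 => /eqP.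
rewrite -[a%:F]divr1 -tofrac1 frac_der_div ?oner_neq0 //.
by rewrite d1 mulr0 subr0 mulr1 expr1n tofrac1 divr1.
Qed.

Let frac_ind (P : {fraction A} -> Prop) :
  (forall a b, b != 0 -> P (a%:F / b%:F)) -> forall f, P f.
Proof. by move=> Pdiv f; rewrite (frac_repr f); apply/Pdiv/denom_ratioP. Qed.

Lemma frac_derM (f g : {fraction A}) :
  frac_der (f * g) = frac_der f * g + f * frac_der g.
Proof.
elim/frac_ind: f => a b nzb; elim/frac_ind: g => a' b' nzb'.
have Fb : b%:F != 0 :> {fraction A} by rewrite tofrac_eq0.
have Fb' : b'%:F != 0 :> {fraction A} by rewrite tofrac_eq0.
rewrite mulf_div -!rmorphM !frac_der_div ?mulf_neq0 // !dM.
rewrite !(rmorphXn, rmorphB, rmorphD, rmorphM) /=.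
exact: quotient_ruleM.
Qed.

Lemma frac_derD : {morph frac_der : f g / f + g}.
Proof.
elim/frac_ind => a b nzb; elim/frac_ind => a' b' nzb'.
have Fb : b%:F != 0 :> {fraction A} by rewrite tofrac_eq0.
have Fb' : b'%:F != 0 :> {fraction A} by rewrite tofrac_eq0.
rewrite addf_div // -!rmorphM -!rmorphD !frac_der_div ?mulf_neq0 // dD !dM.
rewrite !(rmorphXn, rmorphB, rmorphD, rmorphM) /=.
exact: quotient_ruleD.
Qed.

End QuotientRule.

(* The derivation is considered on a subset S of an algebra K; the operator d
   is total on K but only its restriction to S matters. *)
Definition is_derivation_on (F : comNzRingType) (K : algType F)
    (S : set K) (d : K -> K) : Prop :=
  [/\ forall f, S f -> S (d f),
      forall (c : F) f g, S f -> S g -> d (c *: f + g) = c *: d f + d g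
    & forall f g, S f -> S g -> d (f * g) = d f * g + f * d g].

(* U is the internal direct sum of the linear subspaces W k with P k. *)
Definition is_direct_sum (F : comNzRingType) (V : lmodType F) (I : finType)
    (P : pred I) (W : I -> set V) (U : set V) : Prop :=
  [/\ forall k, P k ->
        W k 0 /\ forall (c : F) u v, W k u -> W k v -> W k (c *: u + v),
      forall v, U v <->
        exists2 w : I -> V, forall k, P k -> W k (w k)
                          & v = \sum_(k | P k) w k
    & forall w : I -> V, (forall k, P k -> W k (w k)) ->
        \sum_(k | P k) w k = 0 -> forall k, P k -> w k = 0].

Section Dickson.
Variables (p n : nat).
Local Notation Pn := {mpoly 'F_p[n]}.
Local Notation K := {fraction Pn}.

(* Intended for lists e of length n. All the lists below have length n when
   n >= 1 and the omitted exponent belongs to the list. *)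
Definition bracket (e : seq nat) : Pn :=
  \det (\matrix_(r < n, s < n) ('X_r ^+ (p ^ nth 0%N e s))).

Definition dicksonL : Pn := bracket (iota 0 n).

Definition dicksonLs (s : nat) : Pn := bracket (rem s (iota 0 n.+1)).

Definition dicksonQ (s : nat) : K := (dicksonLs s)%:F / dicksonL%:F.

Definition gl_act (g : 'M['F_p]_n) (f : Pn) : Pn :=
  f \mPo [tuple \sum_(s < n) g r s *: 'X_s | r < n].

Definition dicksonD : set Pn :=
  [set f | forall g : 'M['F_p]_n, g \in unitmx -> gl_act g f = f].

Definition dicksonP (i s : nat) : K :=
  if s is s'.+1
  then - ((bracket (rcons (rem s' (iota 0 n)) i.-1))%:F / dicksonL%:F)
  else 0.

Definition dicksonR (i : nat) : K :=
  (bracket (rcons (iota 0 n.-1) i.-1))%:F / dicksonL%:F.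

Definition dicksonA (i s : nat) : K := dicksonP i s ^+ p.
Definition dicksonB (i : nat) : K := dicksonR i ^+ p.

Definition dicksonI (i s : nat) : K :=
  (dicksonQ s + (dicksonB i)^-1 * dicksonA i s) / dicksonQ 0.

(* The localization D_n[Q_{n,0}^-1, B^-1] inside the field of fractions. *)
Definition dicksonS (i : nat) : set K :=
  [set x | exists f (a b : nat),
     dicksonD f /\ x = f%:F / (dicksonQ 0 ^+ a * dicksonB i ^+ b)].

Definition St_poly (i : nat) (f : Pn) : Pn :=
  \sum_(r < n) 'X_r ^+ (p ^ i) * f^`M(r).

Definition St (i : nat) : K -> K := frac_der (St_poly i).

Definition deltaop (i : nat) (f : K) : K :=
  (-1) ^+ n * (dicksonQ 0)^-1 * St i f.

Definition partialop (i : nat) (f : K) : K := (dicksonB i)^-1 * deltaop i f.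

Definition weight (i : nat) (lam : 'F_p) : set K :=
  [set f | dicksonS i f /\ partialop i f - lam *: f = 0].

(* The product is composition of operators; the factors commute, so the order
   of enumeration of 'F_p is irrelevant. *)
Definition weight_proj (i : nat) (lam : 'F_p) : K -> K :=
  \big[(fun u v : K -> K => u \o v)/id]_(mu : 'F_p | mu != lam)
     (fun f => (lam - mu)^-1 *: (partialop i f - mu *: f)).

End Dickson.

Arguments dicksonD : clear implicits.
Arguments dicksonS : clear implicits.
Arguments gl_act : clear implicits.
Arguments St_poly : clear implicits.
Arguments St : clear implicits.
Arguments deltaop : clear implicits.
Arguments partialop : clear implicits.
Arguments weight : clear implicits.
Arguments weight_proj : clear implicits.

(* St_poly is the unique derivation of the polynomial ring mapping x_r to
   x_r^(p^i); St is a derivation of the field of fractions extending it, and it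
   is the unique extension on every localization of the Dickson algebra. *)
Section StCharacterization.
Variables (p n i : nat).
Local Notation Pn := {mpoly 'F_p[n]}.
Local Notation K := {fraction Pn}.

Lemma St_polyX (r : 'I_n) : St_poly p n i 'X_r = 'X_r ^+ (p ^ i) :> Pn.
Proof.
rewrite /St_poly (bigD1 r) //= big1 => [|k nkr].
  rewrite mderivX mnm1E eqxx scale1r addr0.
  have -> : (U_(r) - U_(r))%MM = 0%MM :> 'X_{1.. n}.
    by apply/mnmP => k; rewrite mnmBE mnm0E subnn.
  by rewrite mpolyX0 mulr1.
by rewrite mderivX mnm1E eq_sym (negPf nkr) scale0r mulr0.
Qed.

Lemma St_poly_linear (c : 'F_p) (f g : Pn) :
  St_poly p n i (c *: f + g) = c *: St_poly p n i f + St_poly p n i g.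
Proof.
rewrite /St_poly scaler_sumr -big_split /=; apply: eq_bigr => r _.
by rewrite mderivD mderivZ mulrDr -scalerAr.
Qed.

Lemma St_polyM (f g : Pn) :
  St_poly p n i (f * g) = St_poly p n i f * g + f * St_poly p n i g.
Proof.
rewrite /St_poly mulr_suml mulr_sumr -big_split /=; apply: eq_bigr => r _.
by rewrite mderivM mulrDr; congr (_ + _); [rewrite mulrA | rewrite mulrCA].
Qed.

Lemma St_poly_unique (d : Pn -> Pn) :
    (forall (c : 'F_p) f g, d (c *: f + g) = c *: d f + d g) ->
    (forall f g, d (f * g) = d f * g + f * d g) ->
    (forall r, d 'X_r = 'X_r ^+ (p ^ i)) ->
  d =1 St_poly p n i.
Proof.
move=> dlin dM dX.
have d0 : d 0 = 0 by have:= dlin (-1) 0 0; rewrite scaler0 addr0 scaleN1r addNr.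
have s0 : St_poly p n i 0 = 0 :> Pn.
  by rewrite /St_poly big1 // => r _; rewrite mderiv0 mulr0.
have sub1 (e : Pn -> Pn) : (forall f g, e (f * g) = e f * g + f * e g) -> e 1 = 0.
  move=> eM; have := eM 1 1; rewrite !mulr1 mul1r => /eqP.
  by rewrite -subr_eq0 opprD addrA subrr sub0r oppr_eq0 => /eqP.
have dXm m : d 'X_[m] = St_poly p n i 'X_[m].
  rewrite mpolyXE_id; elim: (index_enum _) => [|r s IHs].
    by rewrite big_nil sub1 // sub1 //; exact: St_polyM.
  rewrite big_cons dM St_polyM IHs; congr (_ * _ + _).
  elim: (m r) => [|k IHk].
    by rewrite expr0 sub1 // sub1 //; exact: St_polyM.
  by rewrite exprS dM St_polyM IHk dX St_polyX.
elim/mpolyind => [|c m f _ _ IH]; first by rewrite d0 s0.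
by rewrite dlin St_poly_linear dXm IH.
Qed.

Let St_polyD : {morph St_poly p n i : f g / f + g >-> f + g :> Pn}.
Proof. by move=> f g; have := St_poly_linear 1 f g; rewrite !scale1r. Qed.

Lemma St_tofrac (f : Pn) : St p n i f%:F = (St_poly p n i f)%:F.
Proof. exact: frac_der_tofrac St_polyM _. Qed.

Lemma StM (f g : K) : St p n i (f * g) = St p n i f * g + f * St p n i g.
Proof. exact: frac_derM St_polyM _ _. Qed.

Lemma St_linear (c : 'F_p) (f g : K) : St p n i (c *: f + g) = c *: St p n i f + St p n i g.
Proof.
rewrite [St p n i _](frac_derD St_polyD St_polyM) -/(St p n i _) -/(St p n i _).
rewrite frac_scaleE StM St_tofrac; congr (_ + _).
have -> : St_poly p n i c%:MP = 0 :> Pn.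
  by rewrite /St_poly big1 // => r _; rewrite mderivC mulr0.
by rewrite rmorph0 mul0r add0r.
Qed.

Lemma St_unique_loc (S : set K) (d : K -> K) :
    (forall f, dicksonD p n f -> S f%:F) ->
    (forall f g, S f -> S g -> d (f * g) = d f * g + f * d g) ->
    (forall f : Pn, dicksonD p n f -> d f%:F = St p n i f%:F) ->
  forall a b : Pn, dicksonD p n a -> dicksonD p n b -> b != 0 -> S (a%:F / b%:F) ->
  d (a%:F / b%:F) = St p n i (a%:F / b%:F).
Proof.
move=> SD dM dD a b Da Db nzb Sab.
have Fb : b%:F != 0 :> K by rewrite tofrac_eq0.
have E := dM _ _ Sab (SD _ Db); have E' := StM (a%:F / b%:F) b%:F.
move: E E'; rewrite divfK // !dD // => -> /addIr.
by move/(mulIf Fb).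
Qed.

End StCharacterization.

(* Main.v *)
(* Write d for the normalized derivation.  Differentiating the first column of
   the determinant L gives d Q_0 = Q_0, so the unit u = (-1)^n B Q_0 has weight 1,
   d = u^-1 St, and x_r + u^-1 x_r^(p^i) has weight 0: each variable is a sum of
   vectors of weights 0 and -1.  Since weights add under products and p-th powers
   have weight 0, every element of the whole fraction field is a sum of
   eigenvectors of d, whence d^p = d by Fermat.  Lagrange interpolation in d
   preserves the localized Dickson algebra S, so the weight components of an
   element of S lie in S.  Finally delta = B d and St = u d, where B and u are
   units of S of weights 0 and 1, which gives kernels, images and iterates.

   No generation statement for the Dickson algebra is needed: S consists of the
   fractions f / h^k with f invariant, for a single invariant polynomial h whose
   image is Q_0^3 B. *)
Require Import Defs.
From HB Require Import structures.
From mathcomp Require Import all_boot all_order all_algebra all_field.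
From mathcomp Require Import fraction mpoly.
From mathcomp Require Import boolp classical_sets.
From mathcomp Require Import ring.

Set Implicit Arguments.
Unset Strict Implicit.
Unset Printing Implicit Defensive.

Import GRing.Theory.
Local Open Scope ring_scope.
Local Open Scope classical_set_scope.

(** * Eigenspaces and Lagrange projections *)

Section Eigenspaces.
Variables (F : finFieldType) (V : lmodType F) (d : V -> V).
Hypothesis d_linear : forall (c : F) u v, d (c *: u + v) = c *: d u + d v.

Definition eigen (lam : F) (v : V) : Prop := d v = lam *: v.

(** The body copies [weight_proj] with an arbitrary operator [d], so that facts about [lagrange]
    transfer to [weight_proj] by conversion. *)
Definition lagrange (lam : F) : V -> V :=
  \big[(fun u v : V -> V => u \o v)/id]_(mu : F | mu != lam)
     (fun f => (lam - mu)^-1 *: (d f - mu *: f)).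

Definition eigen_sum (v : V) : Prop :=
  exists2 w : F -> V, forall lam, eigen lam (w lam) & v = \sum_lam w lam.

Lemma linear_op0 : d 0 = 0.
Proof. by have := d_linear (-1) 0 0; rewrite scaler0 addr0 scaleN1r addNr. Qed.

Lemma linear_opD u v : d (u + v) = d u + d v.
Proof. by have := d_linear 1 u v; rewrite !scale1r. Qed.

Lemma linear_opZ c u : d (c *: u) = c *: d u.
Proof. by have := d_linear c u 0; rewrite linear_op0 !addr0. Qed.

Lemma linear_op_sum (I : Type) (r : seq I) (P : pred I) (f : I -> V) :
  d (\sum_(k <- r | P k) f k) = \sum_(k <- r | P k) d (f k).
Proof. by apply: (big_morph d linear_opD linear_op0). Qed.

Lemma eigenP lam v : eigen lam v <-> d v - lam *: v = 0.
Proof. by split=> [-> | /subr0_eq //]; rewrite subrr. Qed.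

Lemma eigen0 lam : eigen lam 0.
Proof. by rewrite /eigen linear_op0 scaler0. Qed.

Lemma eigenD lam u v : eigen lam u -> eigen lam v -> eigen lam (u + v).
Proof. by rewrite /eigen linear_opD scalerDr => -> ->. Qed.

Lemma eigenZ lam c v : eigen lam v -> eigen lam (c *: v).
Proof. by rewrite /eigen linear_opZ => ->; rewrite !scalerA mulrC. Qed.

Lemma lagrange_linear lam (c : F) u v :
  lagrange lam (c *: u + v) = c *: lagrange lam u + lagrange lam v.
Proof.
rewrite /lagrange; apply: (big_ind (fun g : V -> V =>
  forall (c : F) u v, g (c *: u + v) = c *: g u + g v)) c u v => //.
  by move=> g h gL hL c u v /=; rewrite hL gL.
move=> mu _ c u v; rewrite d_linear scalerA [c * _]mulrC -scalerA -scalerDr.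
congr (_ *: _); rewrite !scalerBr scalerDr opprD addrACA.
by congr (_ + _); rewrite !scalerA mulrC.
Qed.

(** Every factor acts on an eigenvector as a scalar. If [nu] differs from [lam], the factor at
    [mu = nu] is zero; if they agree, every factor is 1. *)
Lemma lagrange_eigen lam nu v :
  eigen nu v -> lagrange lam v = if nu == lam then v else 0.
Proof.
move=> vE; have -> : lagrange lam v =
    (\prod_(mu | mu != lam) ((lam - mu)^-1 * (nu - mu))) *: v.
  apply: (big_rec2 (fun g a => g v = a *: v)); first by rewrite scale1r.
  move=> mu g a _ gE /=; rewrite gE linear_opZ vE [_ *: (nu *: _)]scalerA.
  by rewrite [_ *: (a *: _)]scalerA -scalerBl scalerA; congr (_ *: _); ring.
case: eqP => [-> | /eqP nulam]; last by rewrite (bigD1 nu) //= subrr mulr0 mul0r scale0r.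
rewrite big1 ?scale1r // => mu mulam.
by rewrite mulVf // subr_eq0 eq_sym.
Qed.

(** The components of a sum of eigenvectors are thus determined by the sum, which gives both the
    projection formula and the independence of eigenspaces. *)
Lemma lagrange_sum lam (w : F -> V) :
  (forall mu, eigen mu (w mu)) -> lagrange lam (\sum_mu w mu) = w lam.
Proof.
move=> wE.
have L0 : lagrange lam 0 = 0.
  have := lagrange_linear lam (-1) 0 0.
  by rewrite scaler0 addr0 scaleN1r addNr.
have LD u v : lagrange lam (u + v) = lagrange lam u + lagrange lam v.
  by have := lagrange_linear lam 1 u v; rewrite !scale1r.
rewrite (big_morph _ LD L0) (bigD1 lam) //= (lagrange_eigen _ (wE lam)) eqxx.
rewrite big1 ?addr0 // => mu mulam.
by rewrite (lagrange_eigen _ (wE mu)) (negPf mulam).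
Qed.

Lemma eigen_sum_eigen lam v : eigen lam v -> eigen_sum v.
Proof.
move=> vE; exists (fun mu => if mu == lam then v else 0).
  by move=> mu; case: eqP => [-> | _] //; exact: eigen0.
by rewrite -big_mkcond big_pred1_eq.
Qed.

Lemma eigen_sumD u v : eigen_sum u -> eigen_sum v -> eigen_sum (u + v).
Proof.
case=> w wE -> [w' w'E ->]; exists (fun lam => w lam + w' lam).
  by move=> lam; apply: eigenD.
by rewrite big_split.
Qed.

Lemma eigen_sum_sum (I : Type) (r : seq I) (P : pred I) (f : I -> V) :
  (forall k, P k -> eigen_sum (f k)) -> eigen_sum (\sum_(k <- r | P k) f k).
Proof.
move=> fE; apply: big_ind => //; last exact: eigen_sumD.
exact/(@eigen_sum_eigen 0)/eigen0.
Qed.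

Lemma iter_eigen m lam v : eigen lam v -> iter m d v = lam ^+ m *: v.
Proof.
move=> vE; elim: m => [|m IHm] /=; first by rewrite scale1r.
by rewrite IHm linear_opZ vE scalerA exprSr.
Qed.

(** On each eigenvector this is Fermat's identity for its eigenvalue. *)
Lemma iter_card_eigen_sum v : eigen_sum v -> iter #|F| d v = d v.
Proof.
case=> w wE ->; rewrite linear_op_sum.
have -> : iter #|F| d (\sum_lam w lam) = \sum_lam iter #|F| d (w lam).
  elim: #|F| => //= k ->; exact: linear_op_sum.
by apply: eq_bigr => lam _; rewrite (iter_eigen _ (wE lam)) expf_card wE.
Qed.

Variable S : set V.
Hypothesis S0 : S 0.
Hypothesis S_linear : forall (c : F) u v, S u -> S v -> S (c *: u + v).
Hypothesis S_stable : forall v, S v -> S (d v).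
Hypothesis S_eigen_sum : forall v, S v -> eigen_sum v.

Definition eigenspace (lam : F) : set V := [set v | S v /\ d v - lam *: v = 0].

Let SZ c v : S v -> S (c *: v).
Proof. by move=> Sv; have := S_linear c Sv S0; rewrite addr0. Qed.

Let SD u v : S u -> S v -> S (u + v).
Proof. by move=> Su Sv; have := S_linear 1 Su Sv; rewrite scale1r. Qed.

(** The summands provided by [eigen_sum] lie only in [V]; since they are values of Lagrange
    polynomials in [d], this stability brings them back into [S]. *)
Lemma lagrange_stable lam v : S v -> S (lagrange lam v).
Proof.
rewrite /lagrange; move: v.
apply: (big_ind (fun g : V -> V => forall v, S v -> S (g v))) => //.
  by move=> g h Sg Sh v Sv; exact/Sg/Sh.
move=> mu _ v Sv; apply/SZ; rewrite addrC -scaleNr.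
by apply: S_linear => //; exact: S_stable.
Qed.

Lemma lagrange_decomp v : S v -> v = \sum_lam lagrange lam v.
Proof.
move=> /S_eigen_sum[w wE ->].
by apply: eq_bigr => lam _; rewrite lagrange_sum.
Qed.

Lemma lagrange_eigenspace lam v : S v -> eigenspace lam (lagrange lam v).
Proof.
move=> Sv; split; first exact: lagrange_stable.
by have [w wE ->] := S_eigen_sum Sv; rewrite lagrange_sum //; exact/eigenP.
Qed.

Lemma eigenspace_direct_sum (P : pred F) (U : set V) :
    (forall v, U v <-> exists2 w : F -> V,
       forall lam, P lam -> eigenspace lam (w lam) & v = \sum_(lam | P lam) w lam) ->
  is_direct_sum P eigenspace U.
Proof.
move=> UE; split=> //.
  move=> lam _; split; first by split; [exact: S0 | exact/eigenP/eigen0].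
  move=> c u v [Su /eigenP uE] [Sv /eigenP vE].
  by split; [exact: S_linear | exact/eigenP/eigenD/vE/eigenZ/uE].
move=> w wE w0 lam Plam.
(* Extending by zero outside [P] gives a family over all scalars with the same sum, to which
   [lagrange_sum] applies. *)
pose w' mu := if P mu then w mu else 0.
have w'E mu : eigen mu (w' mu).
  rewrite /w'; case: ifP => [/wE[_ /eigenP] // | _]; exact: eigen0.
have := lagrange_sum lam w'E; rewrite -big_mkcond w0 /w' Plam => <-.
by have := lagrange_eigen lam (eigen0 lam); rewrite eqxx.
Qed.

Lemma eigenspace_direct_sum_all : is_direct_sum predT eigenspace S.
Proof.
apply: eigenspace_direct_sum => v; split=> [Sv | [w wE ->]].
  exists (lagrange^~ v); last exact: lagrange_decomp.
  by move=> lam _; exact: lagrange_eigenspace.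
by apply: big_ind => // lam /wE[].
Qed.

(* [E] scales the eigenspace of [lam] by [lam], then shifts it bijectively onto
   that of [lam + rho]: it kills exactly the summand landing in weight [rho]. *)
Lemma image_direct_sum (rho : F) (M M' E : V -> V) :
    (forall c u v, M (c *: u + v) = c *: M u + M v) ->
    cancel M' M ->
    (forall lam v, eigenspace lam v -> eigenspace (lam + rho) (M v)) ->
    (forall lam v, eigenspace lam v -> eigenspace (lam - rho) (M' v)) ->
    (forall v, E v = M (d v)) ->
  is_direct_sum (fun lam => lam != rho) eigenspace (E @` S).
Proof.
move=> M_linear M'K ME M'E EE; apply: eigenspace_direct_sum => v.
have M0 : M 0 = 0 by have := M_linear (-1) 0 0; rewrite scaler0 addr0 scaleN1r addNr.
have MD u u' : M (u + u') = M u + M u' by have := M_linear 1 u u'; rewrite !scale1r.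
have MZ c u : M (c *: u) = c *: M u by have := M_linear c u 0; rewrite M0 !addr0.
split=> [[u Su <-] | [w wE ->]].
  (* What lands in weight [lam] comes from the component of [u] of weight [lam - rho], on which [d]
     is multiplication by [lam - rho]. *)
  exists (fun lam => (lam - rho) *: M (lagrange (lam - rho) u)) => [lam _|].
    have [SM /eigenP ME'] := ME _ _ (lagrange_eigenspace (lam - rho) Su).
    by split; [exact: SZ | apply/eigenP/eigenZ; rewrite subrK in ME'].
  rewrite EE {1}(lagrange_decomp Su) linear_op_sum (big_morph _ MD M0).
  rewrite (reindex_inj (addIr (- rho))) /= [RHS]big_mkcond /=.
  apply: eq_bigr => lam _.
  have [_ /eigenP ->] := lagrange_eigenspace (lam - rho) Su.
  by case: eqP => [-> | _] //=; rewrite ?subrr MZ ?scale0r.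
(* The vector [M' (w lam)] has weight [lam - rho], which is nonzero, so the scalar that [d] produces
   can be divided out. *)
exists (\sum_(lam | lam != rho) (lam - rho)^-1 *: M' (w lam)).
  apply: big_ind => // lam /wE/M'E[Sw _]; exact: SZ.
rewrite EE linear_op_sum (big_morph _ MD M0); apply: eq_bigr => lam nz.
have [_ /eigenP /(eigenZ (lam - rho)^-1) ->] := M'E _ _ (wE _ nz).
by rewrite scalerA divff ?subr_eq0 // scale1r M'K.
Qed.

End Eigenspaces.

(** * Bracket determinants *)

Section Brackets.
Variables (p : nat) (p_prime : prime p).

Lemma pchar_mpoly n : p \in [pchar {mpoly 'F_p[n]}].
Proof. by rewrite pchar_lalg pchar_Fp. Qed.

Lemma exprD_pchar n (f g : {mpoly 'F_p[n]}) k :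
  (f + g) ^+ (p ^ k) = f ^+ (p ^ k) + g ^+ (p ^ k).
Proof.
elim: k => [|k IHk]; first by rewrite !expr1.
by rewrite !expnSr !exprM IHk -!(pFrobenius_autE (pchar_mpoly n)) rmorphD.
Qed.

Lemma Fp_expX (c : 'F_p) k : c ^+ (p ^ k) = c.
Proof.
elim: k => [|k IHk] //; rewrite expnSr exprM IHk.
by rewrite -[X in _ ^+ X](card_Fp p_prime) expf_card.
Qed.

Lemma mpoly_alg_ind n (P : {mpoly 'F_p[n]} -> Prop) :
    (forall c, P c%:MP) -> (forall r, P 'X_r) ->
    (forall f g, P f -> P g -> P (f + g)) -> (forall f g, P f -> P g -> P (f * g)) ->
  forall f, P f.
Proof.
move=> PC PX PD PM f; elim/mpolyind: f => [|c m f _ _ Pf]; first by rewrite -mpolyC0.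
apply: (PD) => //; rewrite -mul_mpolyC; apply: (PM) => //; rewrite mpolyXE_id.
apply: big_ind => [| f1 f2|r _]; [by rewrite -mpolyC1 | exact: PM |].
by elim: (m r) => [|k IHk]; [rewrite expr0 -mpolyC1 | rewrite exprS; exact: PM].
Qed.

Lemma gl_actC n g c : gl_act p n g c%:MP = c%:MP.
Proof. exact: comp_mpolyC. Qed.

Lemma gl_actD n g (f h : {mpoly 'F_p[n]}) :
  gl_act p n g (f + h) = gl_act p n g f + gl_act p n g h.
Proof. exact: comp_mpolyD. Qed.

Lemma gl_actM n g (f h : {mpoly 'F_p[n]}) :
  gl_act p n g (f * h) = gl_act p n g f * gl_act p n g h.
Proof. exact: rmorphM. Qed.

Lemma gl_actZ n g c (f : {mpoly 'F_p[n]}) :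
  gl_act p n g (c *: f) = c *: gl_act p n g f.
Proof. exact: comp_mpolyZ. Qed.

Lemma gl_actXn n g (f : {mpoly 'F_p[n]}) k :
  gl_act p n g (f ^+ k) = gl_act p n g f ^+ k.
Proof. exact: rmorphXn. Qed.

Lemma gl_actX n (g : 'M['F_p]_n) r : gl_act p n g 'X_r = \sum_s g r s *: 'X_s.
Proof. by rewrite /gl_act comp_mpolyXU -tnth_nth tnth_mktuple. Qed.

(** Frobenius is additive and fixes the scalars, so all the columns of a bracket transform by the
    same matrix [g]. *)
Lemma gl_actXX n (g : 'M['F_p]_n) r k :
  gl_act p n g ('X_r ^+ (p ^ k)) = \sum_s g r s *: 'X_s ^+ (p ^ k).
Proof.
rewrite gl_actXn gl_actX.
have E0 : (0 : {mpoly 'F_p[n]}) ^+ (p ^ k) = 0.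
  by rewrite expr0n expn_eq0 eqn0Ngt prime_gt0.
rewrite (big_morph (fun f => f ^+ (p ^ k)) (fun f g => exprD_pchar f g k) E0).
by apply: eq_bigr => s _; rewrite exprZn Fp_expX.
Qed.

Lemma gl_act_bracket n (g : 'M['F_p]_n) e :
  gl_act p n g (bracket p n e) = \det g *: bracket p n e.
Proof.
rewrite /bracket /gl_act -det_map_mx -mul_mpolyC -det_map_mx -det_mulmx.
congr (\det _); apply/matrixP => r s; rewrite !mxE.
rewrite /= -/(gl_act p n g _) gl_actXX; apply: eq_bigr => k _.
by rewrite !mxE mul_mpolyC.
Qed.

(** Frobenius is a ring endomorphism, so it commutes with determinants. *)
Lemma bracket_mapS n e : size e = n -> bracket p n (map S e) = bracket p n e ^+ p.
Proof.
move=> size_e; rewrite -(pFrobenius_autE (pchar_mpoly n)) /bracket -det_map_mx.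
congr (\det _); apply/matrixP => r s; rewrite !mxE (nth_map 0%N) ?size_e //.
by rewrite expnSr exprM.
Qed.

(** These minors serve both the expansion of [a :: e] along its first column and that of [rcons e a]
    along its last; only the signs differ. *)
Definition bracket_minor n (e : seq nat) (r : 'I_n.+1) : {mpoly 'F_p[n.+1]} :=
  \det (\matrix_(k < n, s < n) 'X_(lift r k) ^+ (p ^ nth 0%N e s)).

Lemma bracket_minor_mapS n e r :
  size e = n -> @bracket_minor n (map S e) r = bracket_minor e r ^+ p.
Proof.
move=> size_e; rewrite -(pFrobenius_autE (pchar_mpoly _)) /bracket_minor -det_map_mx.
congr (\det _); apply/matrixP => k s; rewrite !mxE (nth_map 0%N) ?size_e //.
by rewrite expnSr exprM.
Qed.

Lemma bracket_cons n a e :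
  bracket p n.+1 (a :: e) =
  \sum_r 'X_r ^+ (p ^ a) * ((-1) ^+ r * bracket_minor e r).
Proof.
rewrite /bracket (expand_det_col _ ord0); apply: eq_bigr => r _.
rewrite mxE /cofactor addn0; congr (_ * (_ * \det _)).
by apply/matrixP => k s; rewrite !mxE lift0.
Qed.

Lemma bracket_rcons n a e : size e = n ->
  bracket p n.+1 (rcons e a) =
  \sum_r 'X_r ^+ (p ^ a) * ((-1) ^+ (r + n) * bracket_minor e r).
Proof.
move=> size_e; rewrite /bracket (expand_det_col _ ord_max); apply: eq_bigr => r _.
rewrite mxE nth_rcons /= size_e ltnn eqxx; congr (_ * (_ * \det _)).
apply/matrixP => k s; rewrite !mxE nth_rcons size_e.
by rewrite lift_max ltn_ord.
Qed.

Lemma bracket_rot n a e : size e = n ->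
  bracket p n.+1 (a :: e) = (-1) ^+ n * bracket p n.+1 (rcons e a).
Proof.
move=> size_e; rewrite bracket_cons bracket_rcons // mulr_sumr.
apply: eq_bigr => r _; rewrite [RHS]mulrCA exprD -mulrA [_ ^+ n * (_ * _)]mulrCA.
by rewrite (mulrA (_ ^+ n)) -expr2 sqrr_sign mul1r.
Qed.

End Brackets.

(** * The Steenrod derivation and the invariant polynomials *)

Section SteenrodPoly.
Variables (p n i : nat) (p_prime : prime p).

Local Notation Pn := {mpoly 'F_p[n]}.
Local Notation St_poly := (St_poly p n i).

Lemma St_polyD (f g : Pn) : St_poly (f + g) = St_poly f + St_poly g.
Proof. by rewrite -[f]scale1r St_poly_linear !scale1r. Qed.

Lemma St_polyC c : St_poly c%:MP = 0.
Proof. by rewrite /Defs.St_poly big1 // => r _; rewrite mderivC mulr0. Qed.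

Lemma St_polyXn (f : Pn) k : St_poly (f ^+ k.+1) = (f ^+ k * St_poly f) *+ k.+1.
Proof.
elim: k => [|k IHk]; first by rewrite expr0 mul1r.
by rewrite exprS St_polyM IHk mulrnAr mulrA -exprS mulrC -mulrS.
Qed.

Lemma St_poly_pchar (f : Pn) : St_poly (f ^+ p) = 0.
Proof.
have pE := prednK (prime_gt0 p_prime).
(* Only the exponent is turned into a successor: [p] also occurs in the coefficient ring. *)
rewrite -(congr1 (fun k => f ^+ k) pE) St_polyXn pE.
by rewrite -mulr_natr (pcharf0 (pchar_mpoly p_prime n)) mulr0.
Qed.

(** On a variable both sides are the same combination of the powers ['X_s ^+ (p ^ i)], by
    [gl_actXX]; sums and products follow from the Leibniz rule. *)
Lemma St_poly_gl_act (g : 'M['F_p]_n) f :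
  St_poly (gl_act p n g f) = gl_act p n g (St_poly f).
Proof.
elim/mpoly_alg_ind: f => [c|r|f h IHf IHh|f h IHf IHh].
- by rewrite gl_actC St_polyC -mpolyC0 gl_actC.
- rewrite St_polyX gl_actXX // gl_actX (linear_op_sum (@St_poly_linear p n i)).
  by apply: eq_bigr => s _; rewrite (linear_opZ (@St_poly_linear p n i)) St_polyX.
- rewrite (St_polyD f h) !gl_actD St_polyD.
  exact (congr2 (fun u v => u + v) IHf IHh).
- rewrite (St_polyM i f h) gl_actD !gl_actM.
  rewrite (St_polyM i (gl_act p n g f)).
  exact (congr2 (fun u v => u * _ + _ * v) IHf IHh).
Qed.

Lemma dicksonD_St f : dicksonD p n f -> dicksonD p n (St_poly f).
Proof. by move=> Df g ug; rewrite -St_poly_gl_act Df. Qed.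

Lemma dicksonD1 : dicksonD p n 1.
Proof. by move=> g _; rewrite -mpolyC1 gl_actC. Qed.

Lemma dicksonDD f g : dicksonD p n f -> dicksonD p n g -> dicksonD p n (f + g).
Proof. by move=> Df Dg h uh; rewrite gl_actD Df ?Dg. Qed.

Lemma dicksonDM f g : dicksonD p n f -> dicksonD p n g -> dicksonD p n (f * g).
Proof. by move=> Df Dg h uh; rewrite gl_actM Df ?Dg. Qed.

Lemma dicksonDZ c f : dicksonD p n f -> dicksonD p n (c *: f).
Proof. by move=> Df h uh; rewrite gl_actZ Df. Qed.

Lemma dicksonDX f k : dicksonD p n f -> dicksonD p n (f ^+ k).
Proof.
move=> Df; elim: k => [|k IHk]; first exact: dicksonD1.
by rewrite exprS; exact: dicksonDM.
Qed.

(** A matrix [g] multiplies the product by the power [a + b] of its determinant, which is 1 by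
    Fermat. *)
Lemma dicksonD_bracketM e e' a b : (p.-1 %| a + b)%N ->
  dicksonD p n (bracket p n e ^+ a * bracket p n e' ^+ b).
Proof.
move=> /dvdnP[k abE] g ug; rewrite gl_actM !gl_actXn.
have nzg : \det g != 0 by rewrite -unitfE -unitmxE.
have g1 : \det g ^+ p.-1 = 1.
  apply: (mulfI nzg); rewrite -exprS prednK ?prime_gt0 // mulr1.
  by have := Fp_expX p_prime (\det g) 1; rewrite expn1.
have scaleE (u v : Pn) : (\det g *: u) ^+ a * (\det g *: v) ^+ b = u ^+ a * v ^+ b.
  rewrite !exprZn -scalerAl -scalerAr scalerA -exprD abE mulnC exprM.
  by rewrite g1 expr1n scale1r.
(* A plain [rewrite] would try to unify the two determinants by computation. *)
exact (etrans (congr2 (fun u v => u ^+ a * v ^+ b)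
  (gl_act_bracket p_prime g e) (gl_act_bracket p_prime g e')) (scaleE _ _)).
Qed.

End SteenrodPoly.

Section SteenrodBracket.
Variables (p n i : nat) (p_prime : prime p).

(** All columns but the first consist of [p]-th powers, which the derivation kills, so only the
    first column is differentiated. *)
Lemma St_poly_bracket e : size e = n ->
  St_poly p n.+1 i (bracket p n.+1 (0%N :: map S e)) = bracket p n.+1 (i :: map S e).
Proof.
move=> size_e; rewrite !bracket_cons (linear_op_sum (@St_poly_linear p _ i)).
apply: eq_bigr => r _; rewrite bracket_minor_mapS // expr1 St_polyM St_polyX.
rewrite -[RHS]addr0; congr (_ + _).
have signE (f : {mpoly 'F_p[n.+1]}) : (-1) ^+ r * f = ((-1) ^+ r : 'F_p) *: f.
  by rewrite -mul_mpolyC rmorph_sign.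
by rewrite signE (linear_opZ (@St_poly_linear p _ i)) St_poly_pchar // scaler0 mulr0.
Qed.

(** Since [i] is positive, every exponent index is now a successor and Frobenius can be pulled out:
    this is the origin of the [p]-th powers in [dicksonA] and [dicksonB]. *)
Lemma St_poly_bracket_pred e : size e = n -> (0 < i)%N ->
  St_poly p n.+1 i (bracket p n.+1 (0%N :: map S e))
  = (-1) ^+ n * bracket p n.+1 (rcons e i.-1) ^+ p.
Proof.
move=> size_e i_gt0; rewrite St_poly_bracket // bracket_rot ?size_map //.
by rewrite -{1}(prednK i_gt0) -map_rcons bracket_mapS // size_rcons size_e.
Qed.

End SteenrodBracket.

(** * Weights in the fraction field *)

Section FractionDerivation.
Variables (p n i : nat) (p_prime : prime p).

Local Notation K := {fraction {mpoly 'F_p[n]}}.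

Lemma pchar_frac : p \in [pchar K].
Proof. by rewrite pchar_lalg pchar_Fp. Qed.

Lemma frac_signE k (f : K) : (-1) ^+ k * f = ((-1) ^+ k : 'F_p) *: f.
Proof. by rewrite frac_scaleE !rmorph_sign. Qed.

Lemma frac_mulrn_predp (f : K) : f *+ p.-1 = - f.
Proof.
apply/eqP; rewrite -addr_eq0 addrC -mulrS prednK ?prime_gt0 //.
by rewrite -mulr_natr (pcharf0 pchar_frac) mulr0.
Qed.

Lemma frac_scaleMr (c : 'F_p) (f g : K) : c *: (f * g) = f * (c *: g).
Proof. by rewrite !frac_scaleE mulrCA. Qed.

Variable D : K -> K.
Hypothesis D_linear : forall (c : 'F_p) f g, D (c *: f + g) = c *: D f + D g.
Hypothesis DM : forall f g, D (f * g) = D f * g + f * D g.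
Hypothesis DX : forall r, D ('X_r)%:F = ('X_r)%:F ^+ (p ^ i).

Lemma der1 : D 1 = 0.
Proof.
have /eqP := DM 1 1; rewrite !mulr1 mul1r.
by rewrite -subr_eq0 opprD addrA subrr sub0r oppr_eq0 => /eqP.
Qed.

Lemma derXn (f : K) k : D (f ^+ k.+1) = (f ^+ k * D f) *+ k.+1.
Proof.
elim: k => [|k IHk]; first by rewrite expr0 mul1r.
by rewrite exprS DM IHk mulrnAr mulrA -exprS mulrC -mulrS.
Qed.

Lemma der_predp (f : K) : D (f ^+ p.-1) = - (f ^+ p.-2 * D f).
Proof.
have pE : p.-1 = p.-2.+1 by case: p p_prime => [|[|k]].
by rewrite -frac_mulrn_predp {3}pE -derXn -pE.
Qed.

Lemma der_pchar (f : K) : D (f ^+ p) = 0.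
Proof.
have pE := prednK (prime_gt0 p_prime).
rewrite -(congr1 (fun k => f ^+ k) pE) derXn pE.
by rewrite -mulr_natr (pcharf0 pchar_frac) mulr0.
Qed.

Variable u : K.
Hypothesis u_neq0 : u != 0.
Variable d : K -> K.
Hypothesis dE : forall f, d f = u^-1 * D f.

Local Notation weightvec := (@eigen 'F_p K d).

Lemma scaled_der_linear (c : 'F_p) f g : d (c *: f + g) = c *: d f + d g.
Proof. by rewrite !dE D_linear mulrDr frac_scaleMr. Qed.

Lemma scaled_derM f g : d (f * g) = d f * g + f * d g.
Proof. by rewrite !dE DM mulrDr mulrA [u^-1 * (f * _)]mulrCA. Qed.

Lemma weightvecM lam mu f g :
  weightvec lam f -> weightvec mu g -> weightvec (lam + mu) (f * g).
Proof.
by rewrite /eigen => fE gE; rewrite scaled_derM fE gE -frac_scaleAl -frac_scaleMr -scalerDl.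
Qed.

Lemma weightvec1 : weightvec 0 1.
Proof. by rewrite /eigen dE der1 mulr0 scale0r. Qed.

Lemma weightvecX lam f k : weightvec lam f -> weightvec (lam *+ k) (f ^+ k).
Proof.
move=> fE; elim: k => [|k IHk]; first by rewrite mulr0n; exact: weightvec1.
by rewrite exprS mulrS; exact: weightvecM.
Qed.

Lemma weightvec_pchar f : weightvec 0 (f ^+ p).
Proof. by rewrite /eigen dE der_pchar mulr0 scale0r. Qed.

Lemma weightvecV lam f : weightvec lam f -> weightvec (- lam) f^-1.
Proof.
(* The inverse of 0 is 0 by convention, and 0 has every weight. *)
have [-> _ | nzf fE] := eqVneq f 0.
  by rewrite invr0; exact: (eigen0 scaled_der_linear).
have := scaled_derM f f^-1; rewrite mulfV // fE weightvec1 scale0r -frac_scaleAl mulfV //.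
move/esym/eqP; rewrite addrC addr_eq0 => /eqP dfV.
by apply: (mulfI nzf); rewrite dfV -frac_scaleMr mulfV // scaleNr.
Qed.

Hypothesis u_weight : weightvec 1 u.
Hypothesis i_gt0 : (0 < i)%N.

(* [x_r = (x_r + u^-1 x_r^(p^i)) - u^-1 x_r^(p^i)] is the sum of a vector of
   weight [0] and one of weight [-1]; fractions reduce to polynomials because
   [f / g = f g^(p-1) / g^p] and [g^p] has weight [0]. *)
Lemma weight_decomposition f : eigen_sum (F := 'F_p) d f.
Proof.
have dL := scaled_der_linear.
have esM f1 f2 : eigen_sum (F := 'F_p) d f1 -> eigen_sum (F := 'F_p) d f2 ->
    eigen_sum (F := 'F_p) d (f1 * f2).
  case=> w1 w1E -> [w2 w2E ->]; rewrite mulr_suml.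
  apply: (eigen_sum_sum dL) => lam _; rewrite mulr_sumr.
  apply: (eigen_sum_sum dL) => mu _.
  exact: (eigen_sum_eigen dL (weightvecM (w1E lam) (w2E mu))).
have polyE (h : {mpoly 'F_p[n]}) : eigen_sum (F := 'F_p) d h%:F.
  elim/mpoly_alg_ind: h => [c|r|h1 h2 Eh1 Eh2|h1 h2 Eh1 Eh2].
  - apply: (eigen_sum_eigen dL (lam := 0)).
    rewrite -[_%:F]mulr1 -frac_scaleE; exact: (eigenZ dL _ weightvec1).
  - set x : K := ('X_r)%:F; pose a := u^-1 * x ^+ (p ^ i).
    (* As [i] is positive, the power of [x] is a [p]-th power of weight 0, and the weight of [a] is
       that of [u^-1]. *)
    have aE : weightvec (-1) a.
      rewrite -[-1]addr0; apply: weightvecM; first exact: weightvecV.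
      by rewrite -(prednK i_gt0) expnSr exprM; exact: weightvec_pchar.
    have xE : d x = a by rewrite dE DX.
    have -> : x = (x + a) - a by rewrite addrK.
    apply: (eigen_sumD dL); last first.
      apply: (eigen_sum_eigen dL (lam := -1)); rewrite -scaleN1r.
      exact: (eigenZ dL).
    apply: (eigen_sum_eigen dL (lam := 0)).
    by rewrite /eigen (linear_opD dL) xE aE scaleN1r subrr scale0r.
  - by rewrite rmorphD; exact: (eigen_sumD dL).
  - by rewrite rmorphM; exact: esM.
rewrite (frac_repr f); move: (denom_ratioP (repr f)).
move: (\n_(repr f)) (\d_(repr f)) => a b nzb.
have nzb' : b%:F != 0 :> K by rewrite tofrac_eq0.
have -> : a%:F / b%:F = (a * b ^+ p.-1)%:F * (b%:F ^+ p)^-1 :> K.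
  have bE : b%:F ^+ p = b%:F * b%:F ^+ p.-1 :> K.
    by rewrite -exprS prednK ?prime_gt0.
  by rewrite rmorphM rmorphXn bE invfM mulrACA divff ?expf_neq0 // mulr1.
apply: esM; first exact: polyE.
apply: (eigen_sum_eigen dL (lam := 0)).
by rewrite -[0]oppr0; exact/weightvecV/weightvec_pchar.
Qed.

(** Since [D] is [u] times [d], each application raises the weight by 1: after [r] steps the vector
    has weight [lam + r], and the next step contributes this scalar and one more [u]. *)
Lemma iter_der_weightvec lam f m : weightvec lam f ->
  iter m D f = u ^+ m * ((\prod_(r < m) (lam + r%:R)) *: f).
Proof.
move=> fE; have DE g : D g = u * d g by rewrite dE mulVKf.
elim: m => [|m IHm]; first by rewrite big_ord0 scale1r mul1r.
rewrite iterS IHm big_ord_recr /= -frac_scaleMr DE (linear_opZ scaled_der_linear).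
have fmE : weightvec (lam + m%:R) (u ^+ m * f).
  by rewrite addrC; exact: (weightvecM (weightvecX m u_weight) fE).
by rewrite fmE scalerA -frac_scaleMr mulrA -exprS frac_scaleMr.
Qed.

End FractionDerivation.

(** * Localizations of the invariants *)

Section Localization.
Variables (p n i : nat) (p_prime : prime p) (h : {mpoly 'F_p[n]}).

Local Notation K := {fraction {mpoly 'F_p[n]}}.
Local Notation D := (dicksonD p n).

Hypotheses (h_neq0 : h != 0) (Dh : D h).

(** With powers of a single denominator, sums and the quotient rule need no bookkeeping of two
    exponents. *)
Definition dickson_loc : set K :=
  [set x | exists f k, D f /\ x = f%:F / h%:F ^+ k].

Let hX_neq0 k : h%:F ^+ k != 0 :> K.
Proof. by apply: expf_neq0; rewrite tofrac_eq0. Qed.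

Lemma dickson_loc_tofrac f : D f -> dickson_loc f%:F.
Proof. by move=> Df; exists f, 0%N; rewrite expr0 divr1. Qed.

Lemma dickson_loc_div f : D f -> dickson_loc (f%:F / h%:F).
Proof. by move=> Df; exists f, 1%N; rewrite expr1. Qed.

Lemma dickson_locM x y : dickson_loc x -> dickson_loc y -> dickson_loc (x * y).
Proof.
case=> [f [k [Df ->]]] [g [l [Dg ->]]]; exists (f * g), (k + l)%N.
by split; [exact: dicksonDM | rewrite mulf_div rmorphM exprD].
Qed.

Lemma dickson_locX x k : dickson_loc x -> dickson_loc (x ^+ k).
Proof.
move=> Sx; elim: k => [|k IHk].
  by rewrite expr0 -tofrac1; exact/dickson_loc_tofrac/dicksonD1.
by rewrite exprS; exact: dickson_locM.
Qed.

Lemma dickson_loc_linear (c : 'F_p) x y :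
  dickson_loc x -> dickson_loc y -> dickson_loc (c *: x + y).
Proof.
case=> [f [k [Df ->]]] [g [l [Dg ->]]].
exists (c *: f * h ^+ l + g * h ^+ k), (k + l)%N; split.
  exact: (dicksonDD (dicksonDM (dicksonDZ c Df) (dicksonDX l Dh))
    (dicksonDM Dg (dicksonDX k Dh))).
rewrite rmorphD !rmorphM !rmorphXn frac_scaleAl -tofracZ exprD.
exact: (addf_div _ _ (hX_neq0 k) (hX_neq0 l)).
Qed.

Lemma dickson_loc_St x : dickson_loc x -> dickson_loc (St p n i x).
Proof.
case=> [f [k [Df ->]]]; rewrite -rmorphXn.
rewrite /St (frac_der_div (@St_polyM p n i)); last by rewrite expf_neq0.
exists (St_poly p n i f * h ^+ k + (-1) *: (f * St_poly p n i (h ^+ k))), (k * 2)%N.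
split; last by rewrite scaleN1r rmorphXn exprM !rmorphXn.
have DSt (g : {mpoly 'F_p[n]}) := dicksonD_St i p_prime (f := g).
exact: (dicksonDD (dicksonDM (DSt _ Df) (dicksonDX k Dh))
  (dicksonDZ (-1) (dicksonDM Df (DSt _ (dicksonDX k Dh))))).
Qed.

End Localization.

(** * Field identities for the weight computations *)

Section Identities.
Variables (F : fieldType) (l e x y z s dQ : F).
Hypotheses (l_neq0 : l != 0) (e_neq0 : e != 0) (x_neq0 : x != 0).

(** Here [l] stands for L, [e] for the power p-2 of L, [x] for the [p]-th power of the bracket in R,
    and [s] for the sign. Thus [l * e] is Q_0 and [x / (l * (l * e))] is B. *)
Lemma der_Q0_identity :
  - (e * (s * x)) = - s * (x / (l * (l * e))) * (l * e) * (l * e).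
Proof. by field; rewrite l_neq0 e_neq0. Qed.

Lemma B_Q0_identity : x * e = x / (l * (l * e)) * (l * e) ^+ 2.
Proof. by field; rewrite l_neq0 e_neq0. Qed.

(** The hypothesis is the derivative of [(y / l) * l = y], where [y] is L_{n,s} and [s * z] its
    image under the derivation. *)
Lemma der_Qs_identity : dQ * l + y / l * (s * x) = s * z ->
  dQ = - s * (x / (l * (l * e))) * (l * e)
       * (y / l + (x / (l * (l * e)))^-1 * - (z / (l * (l * e)))).
Proof.
move/(canRL (addrK _))/(canRL (mulfK l_neq0)) => ->.
by field; rewrite l_neq0 e_neq0 x_neq0.
Qed.

End Identities.

Section LocalizationIdentities.
Variables (F : fieldType) (q b h c f : F).
Hypotheses (q_neq0 : q != 0) (b_neq0 : b != 0) (cE : c = b * q ^+ 2) (hE : h = q * c).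

Lemma localization_Q0V : q^-1 = c / h.
Proof. by rewrite hE cE; field; rewrite b_neq0 q_neq0. Qed.

Lemma localization_BV : b^-1 = q ^+ 3 / h.
Proof. by rewrite hE cE; field; rewrite b_neq0 q_neq0. Qed.

Lemma localization_hX k : f / h ^+ k = f / (q ^+ (3 * k) * b ^+ k).
Proof. by rewrite exprM -exprMn hE cE; congr (_ / _ ^+ _); ring. Qed.

Lemma localization_split k l : f / (q ^+ k * b ^+ l) = f * q^-1 ^+ k * b^-1 ^+ l.
Proof. by rewrite invfM !exprVn mulrA. Qed.

End LocalizationIdentities.

(** * Exponents p and p-1 rewritten through p-2 *)

Section PrimePowers.
Variables (p : nat) (p_prime : prime p).

Lemma expr_pred (R : comPzRingType) (f : R) : f ^+ p.-1 = f * f ^+ p.-2.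
Proof. by rewrite -exprS; case: p p_prime => [|[|k]]. Qed.

Lemma expr_pred2 (R : comPzRingType) (f : R) : f ^+ p = f * (f * f ^+ p.-2).
Proof. by rewrite -!exprS; case: p p_prime => [|[|k]]. Qed.

Lemma expr_div_pred2 (F : fieldType) (f g : F) :
  (f / g) ^+ p = f ^+ p / (g * (g * g ^+ p.-2)).
Proof. by rewrite exprMn exprVn (expr_pred2 g). Qed.

Lemma expr_opp_div_pred2 (F : fieldType) (f g : F) : odd p ->
  (- (f / g)) ^+ p = - (f ^+ p / (g * (g * g ^+ p.-2))).
Proof. by move=> p_odd; rewrite exprNn -signr_odd p_odd expr1 mulN1r expr_div_pred2. Qed.

Lemma expr_div_pred (F : fieldType) (f : F) : f != 0 -> f ^+ p / f = f ^+ p.-1.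
Proof. by move=> nzf; rewrite expr_pred2 expr_pred mulrC mulKf. Qed.

(** For [g] equal to L this replaces the denominator L, not invariant in general, by its power p-1,
    which is Q_0. *)
Lemma div_expr_pred (F : fieldType) (f g : F) : g != 0 ->
  f / g = f * g ^+ p.-2 * (g ^+ p.-1)^-1.
Proof.
move=> nzg; rewrite expr_pred; move: (expf_neq0 p.-2 nzg) => nze.
by field; rewrite nzg nze.
Qed.

Lemma div_expr_pred2 (F : fieldType) (f g : F) : g != 0 ->
  f / (g * (g * g ^+ p.-2)) = f * g ^+ p.-2 * (g ^+ p.-1)^-1 * (g ^+ p.-1)^-1.
Proof.
move=> nzg; rewrite expr_pred; move: (expf_neq0 p.-2 nzg) => nze.
by field; rewrite nzg nze.
Qed.

(** Division by 0 yields 0, so the assumption that B is nonzero also forces L to be nonzero. *)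
Lemma expr_div_neq0 (F : fieldType) (f g : F) : (f / g) ^+ p != 0 -> (f != 0) /\ (g != 0).
Proof. by rewrite expf_eq0 prime_gt0 // mulf_eq0 invr_eq0 negb_or => /andP. Qed.

End PrimePowers.

(** * Weights of the Dickson invariants *)

Section DicksonInvariants.
Variables (p m i : nat) (p_prime : prime p) (p_odd : odd p) (i_gt0 : (0 < i)%N).

Local Notation n := m.+1.
Local Notation K := {fraction {mpoly 'F_p[n]}}.
Local Notation L := (dicksonL p n).
Local Notation M := (bracket p n (rcons (iota 0 m) i.-1)).
Local Notation Q := (dicksonQ p n).
Local Notation B := (dicksonB p n i).
Local Notation A := (dicksonA p n i).
Local Notation D := (dicksonD p n).
Local Notation DS := (dicksonS p n i).
Local Notation St := (St p n i).

Lemma St_fracX (r : 'I_n) : St ('X_r)%:F = ('X_r)%:F ^+ (p ^ i).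
Proof. by rewrite St_tofrac St_polyX rmorphXn. Qed.

Lemma iota0S k : iota 0 k.+1 = 0%N :: map S (iota 0 k).
Proof. by rewrite /= (iotaDl 1 0). Qed.

Lemma dicksonL_cons : L = bracket p n (0%N :: map S (iota 0 m)).
Proof. by rewrite /dicksonL iota0S. Qed.

Lemma dicksonLs0 : dicksonLs p n 0 = L ^+ p.
Proof. by rewrite /dicksonLs iota0S rem_cons bracket_mapS ?size_iota. Qed.

(** Omitting a positive index keeps 0 in front of a shifted list, the shape to which
    [St_poly_bracket_pred] applies. *)
Lemma dicksonLs_cons s :
  dicksonLs p n s.+1 = bracket p n (0%N :: map S (rem s (iota 0 n))).
Proof.
rewrite /dicksonLs (iota0S n) rem_cons; congr (bracket p n (_ :: _)).
by rewrite !rem_filter ?(map_inj_uniq succn_inj) ?iota_uniq // filter_map.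
Qed.

Lemma size_rem_iota s : (s < n)%N -> size (rem s (iota 0 n)) = m.
Proof. by move=> s_lt; rewrite size_rem ?size_iota // mem_iota. Qed.

Lemma St_dicksonL : St L%:F = (-1) ^+ m * M%:F ^+ p.
Proof.
rewrite St_tofrac dicksonL_cons St_poly_bracket_pred ?size_iota //.
by rewrite rmorphM rmorph_sign rmorphXn.
Qed.

Lemma St_dicksonLs s : (s < n)%N ->
  St (dicksonLs p n s.+1)%:F
  = (-1) ^+ m * (bracket p n (rcons (rem s (iota 0 n)) i.-1))%:F ^+ p.
Proof.
move=> s_lt; rewrite St_tofrac dicksonLs_cons St_poly_bracket_pred ?size_rem_iota //.
by rewrite rmorphM rmorph_sign rmorphXn.
Qed.

Hypothesis B_neq0 : B != 0.

Lemma dicksonL_neq0 : L%:F != 0 :> K.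
Proof. exact: (expr_div_neq0 p_prime B_neq0).2. Qed.

Lemma bracketR_neq0 : M%:F != 0 :> K.
Proof. exact: (expr_div_neq0 p_prime B_neq0).1. Qed.

Lemma dicksonQ0E : Q 0 = L%:F ^+ p.-1.
Proof.
rewrite /dicksonQ dicksonLs0 rmorphXn.
exact: (expr_div_pred p_prime dicksonL_neq0).
Qed.

Lemma dicksonQ0_neq0 : Q 0 != 0.
Proof. by rewrite dicksonQ0E; exact: (expf_neq0 _ dicksonL_neq0). Qed.

Lemma dicksonBE : B = M%:F ^+ p / (L%:F * (L%:F * L%:F ^+ p.-2)).
Proof. exact: (expr_div_pred2 p_prime). Qed.

Lemma dicksonAE s : A s.+1 =
  - ((bracket p n (rcons (rem s (iota 0 n)) i.-1))%:F ^+ p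
     / (L%:F * (L%:F * L%:F ^+ p.-2))).
Proof. exact: (expr_opp_div_pred2 p_prime). Qed.

Definition St_unit : K := (-1) ^+ n * B * Q 0.
Local Notation u := St_unit.

Lemma St_unit_neq0 : u != 0.
Proof.
exact: (mulf_neq0 (mulf_neq0 (expf_neq0 _ (lreg_neq0 (@lregN _ _ (@lreg1 _)))) B_neq0)
  dicksonQ0_neq0). Qed.

Lemma partialopE f : partialop p n i f = u^-1 * St f.
Proof.
by rewrite /partialop /deltaop /St_unit !invfM invr_sign !mulrA [B^-1 * _]mulrC.
Qed.

Lemma St_unitE :
  u = - (-1) ^+ m * (M%:F ^+ p / (L%:F * (L%:F * L%:F ^+ p.-2))) * (L%:F * L%:F ^+ p.-2).
Proof.
have signE (R : pzRingType) (b b' q q' : R) : b = b' -> q = q' ->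
    (-1) ^+ n * b * q = - (-1) ^+ m * b' * q' by move=> -> ->; rewrite exprS mulN1r.
exact: (signE _ _ _ _ _ dicksonBE (etrans dicksonQ0E (expr_pred p_prime _))).
Qed.

Local Notation d := (partialop p n i).
Local Notation weightvec := (@eigen 'F_p K d).

Lemma partialop_eq f g : St f = u * g -> d f = g.
Proof. by rewrite partialopE => ->; exact: (mulKf St_unit_neq0). Qed.

(** Differentiating the power p-1 of L brings out the factor p-1 = -1, which accounts for the
    difference between the sign of exponent [m] in [St_dicksonL] and that of exponent [m.+1] in the
    unit. *)
Lemma weight_Q0 : weightvec 1 (Q 0).
Proof.
rewrite /eigen scale1r; apply: partialop_eq.
have lE := etrans dicksonQ0E (expr_pred p_prime L%:F).
rewrite {1}dicksonQ0E (der_predp p_prime (@StM p n i)) St_dicksonL {1}St_unitE {1}lE.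
exact: (der_Q0_identity _ _ dicksonL_neq0 (expf_neq0 _ dicksonL_neq0)).
Qed.

(** The product rule for Q_{n,s} L = L_{n,s} is solved for the derivative of Q_{n,s}, the other two
    derivatives being known brackets. *)
Lemma partial_dicksonQ s : (s < m)%N -> d (Q s.+1) = Q s.+1 + B^-1 * A s.+1.
Proof.
move=> s_lt; apply: partialop_eq.
have QL : Q s.+1 * L%:F = (dicksonLs p n s.+1)%:F by exact: (divfK dicksonL_neq0).
have dQE := etrans (congr1 (fun t => St (Q s.+1) * L%:F + Q s.+1 * t) (esym St_dicksonL))
  (etrans (esym (StM i (Q s.+1) L%:F)) (etrans (congr1 St QL) (St_dicksonLs (ltnW s_lt)))).
rewrite St_unitE dicksonAE dicksonBE.
exact: (der_Qs_identity dicksonL_neq0 (expf_neq0 _ dicksonL_neq0)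
  (expf_neq0 _ bracketR_neq0) dQE).
Qed.

Let d_linear := scaled_der_linear (@St_linear p n i) partialopE.

Lemma weight_B : weightvec 0 B.
Proof. exact: (weightvec_pchar p_prime (@StM p n i) partialopE). Qed.

Lemma weight_unit : weightvec 1 u.
Proof.
rewrite /St_unit -mulrA frac_signE; apply: (eigenZ d_linear).
by rewrite -[1]add0r; exact: (weightvecM (@StM p n i) partialopE weight_B weight_Q0).
Qed.

(** The numerator has weight 1: by [partial_dicksonQ] it is the image of Q_{n,s}, and its second
    term is a [p]-th power, hence killed. Dividing by Q_0 lowers the weight to 0. *)
Lemma weight_I s : (s < m)%N -> weightvec 0 (dicksonI p n i s.+1).
Proof.
move=> s_lt; rewrite /dicksonI -(subrr 1).
apply: (weightvecM (@StM p n i) partialopE); last first.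
  exact: (weightvecV (@St_linear p n i) (@StM p n i) partialopE weight_Q0).
rewrite /eigen scale1r (linear_opD d_linear) partial_dicksonQ //.
have -> : d (B^-1 * A s.+1) = 0; last by rewrite addr0.
rewrite -exprVn -exprMn.
by rewrite (weightvec_pchar p_prime (@StM p n i) partialopE) scale0r.
Qed.


(** * The ring S as a localization at one invariant polynomial *)

Definition loc_q : {mpoly 'F_p[n]} := L ^+ p.-1.
(** The exponents add up to 2(p-1), so the determinant factors cancel; the image is B times the
    square of Q_0. *)
Definition loc_b : {mpoly 'F_p[n]} := M ^+ p * L ^+ p.-2.
Definition loc_h : {mpoly 'F_p[n]} := loc_q * loc_b.

Lemma dicksonD_q : D loc_q.
Proof.
have : D (L ^+ p.-1 * L ^+ 0) by apply: (dicksonD_bracketM p_prime); rewrite addn0.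
by rewrite expr0 mulr1.
Qed.

Lemma dicksonD_b : D loc_b.
Proof.
apply: (dicksonD_bracketM p_prime); apply/dvdnP; exists 2%N.
by case: p p_prime => [|[|k]] //= _; rewrite mul2n -addnn addSnnS.
Qed.

Lemma dicksonD_h : D loc_h.
Proof. exact: (dicksonDM dicksonD_q dicksonD_b). Qed.

Lemma loc_qE : loc_q%:F = Q 0.
Proof. by rewrite dicksonQ0E /loc_q rmorphXn. Qed.

Lemma loc_bE : loc_b%:F = B * Q 0 ^+ 2.
Proof.
rewrite dicksonQ0E dicksonBE /loc_b rmorphM !rmorphXn.
exact: (etrans (B_Q0_identity _ dicksonL_neq0 (expf_neq0 _ dicksonL_neq0))
  (congr1 (fun t => _ * t ^+ 2) (esym (expr_pred p_prime L%:F)))).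
Qed.

Lemma loc_hE : loc_h%:F = Q 0 * loc_b%:F.
Proof. by rewrite -loc_qE; exact: rmorphM. Qed.

Lemma loc_h_neq0 : loc_h != 0.
Proof.
rewrite -(tofrac_eq0 loc_h) loc_hE loc_bE.
exact: (mulf_neq0 dicksonQ0_neq0 (mulf_neq0 B_neq0 (expf_neq0 _ dicksonQ0_neq0))).
Qed.

Local Notation loc := (dickson_loc loc_h).

Lemma loc_Q0V : loc (Q 0)^-1.
Proof.
rewrite (localization_Q0V dicksonQ0_neq0 B_neq0 loc_bE loc_hE).
exact: (dickson_loc_div _ dicksonD_b).
Qed.

Lemma loc_BV : loc B^-1.
Proof.
rewrite (localization_BV dicksonQ0_neq0 B_neq0 loc_bE loc_hE) -{1}loc_qE -rmorphXn.
exact: (dickson_loc_div _ (dicksonDX 3 dicksonD_q)).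
Qed.

(** The inverses of Q_0 and B are both fractions over [loc_h]; conversely the power [k] of [loc_h]
    is Q_0^(3k) B^k. *)
Lemma dicksonSE : DS = loc.
Proof.
apply/seteqP; split=> x.
  case=> f [a [b [Df ->]]]; rewrite localization_split.
  apply: dickson_locM; last exact: (dickson_locX _ loc_BV).
  by apply: dickson_locM; [exact: dickson_loc_tofrac | exact: (dickson_locX _ loc_Q0V)].
case=> f [k [Df ->]]; exists f, (3 * k)%N, k; split => //.
exact: (localization_hX _ loc_bE loc_hE).
Qed.

Lemma dicksonS_tofrac f : D f -> DS f%:F.
Proof. by rewrite dicksonSE; exact: dickson_loc_tofrac. Qed.

Lemma dicksonSM x y : DS x -> DS y -> DS (x * y).
Proof. by rewrite dicksonSE; exact: dickson_locM. Qed.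

Lemma dicksonS_linear (c : 'F_p) x y : DS x -> DS y -> DS (c *: x + y).
Proof. by rewrite dicksonSE; exact: (dickson_loc_linear loc_h_neq0 dicksonD_h). Qed.

Lemma dicksonS_Q0V : DS (Q 0)^-1.
Proof. by rewrite dicksonSE; exact: loc_Q0V. Qed.

Lemma dicksonS_BV : DS B^-1.
Proof. by rewrite dicksonSE; exact: loc_BV. Qed.

Lemma dicksonS_St x : DS x -> DS (St x).
Proof. by rewrite dicksonSE; exact: (dickson_loc_St _ p_prime loc_h_neq0 dicksonD_h). Qed.

Lemma dicksonS0 : DS 0.
Proof.
rewrite -tofrac0; apply: dicksonS_tofrac; rewrite -(scale0r 1).
exact/dicksonDZ/dicksonD1.
Qed.

Lemma dicksonSZ (c : 'F_p) x : DS x -> DS (c *: x).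
Proof. by move=> Sx; rewrite -[_ *: _]addr0; exact/dicksonS_linear/dicksonS0. Qed.

Lemma dicksonS_Q0 : DS (Q 0).
Proof. by rewrite -loc_qE; exact/dicksonS_tofrac/dicksonD_q. Qed.

Lemma dicksonS_B : DS B.
Proof.
have -> : B = loc_b%:F * ((Q 0)^-1 * (Q 0)^-1).
  rewrite loc_bE -invfM; exact: (esym (mulfK (mulf_neq0 dicksonQ0_neq0 dicksonQ0_neq0) B)).
apply: dicksonSM; first exact/dicksonS_tofrac/dicksonD_b.
exact: (dicksonSM dicksonS_Q0V dicksonS_Q0V).
Qed.

Lemma dicksonS_unit : DS u.
Proof.
rewrite /St_unit -mulrA frac_signE.
exact/dicksonSZ/(dicksonSM dicksonS_B dicksonS_Q0).
Qed.

Lemma dicksonS_unitV : DS u^-1.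
Proof.
have -> : u^-1 = (-1) ^+ n * (B^-1 * (Q 0)^-1).
  by rewrite /St_unit (invfM (_ * B)) (invfM _ B) invr_sign mulrA.
rewrite frac_signE; exact/dicksonSZ/(dicksonSM dicksonS_BV dicksonS_Q0V).
Qed.

Lemma dicksonS_partial x : DS x -> DS (d x).
Proof.
move=> Sx; rewrite partialopE; exact: (dicksonSM dicksonS_unitV (dicksonS_St Sx)).
Qed.

Lemma dicksonS_bracketM e a : (p.-1 %| a + p.-2)%N ->
  DS ((bracket p n e)%:F ^+ a * L%:F ^+ p.-2).
Proof.
have fracE (f g : {mpoly 'F_p[n]}) k : (f ^+ a * g ^+ k)%:F = f%:F ^+ a * g%:F ^+ k :> K.
  by rewrite rmorphM !rmorphXn.
move=> dvd_a; rewrite -fracE; apply: dicksonS_tofrac.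
exact: (dicksonD_bracketM p_prime).
Qed.

Lemma dicksonS_Q s : DS (Q s).
Proof.
have -> : Q s = (dicksonLs p n s)%:F ^+ 1 * L%:F ^+ p.-2 * (Q 0)^-1.
  exact: (etrans (div_expr_pred p_prime _ dicksonL_neq0)
    (congr1 (fun t => _ * t^-1) (esym dicksonQ0E))).
apply: (dicksonSM _ dicksonS_Q0V); apply: dicksonS_bracketM.
by rewrite add1n; case: p p_prime => [|[|k]] // _; exact: dvdnn.
Qed.

(** Multiplying numerator and denominator by the power p-2 of L makes the numerator invariant and
    the denominator the square of Q_0. *)
Lemma dicksonS_A s : DS (A s.+1).
Proof.
rewrite dicksonAE -scaleN1r; apply: dicksonSZ.
rewrite (etrans (div_expr_pred2 p_prime _ dicksonL_neq0)
  (congr1 (fun t => _ * t^-1 * t^-1) (esym dicksonQ0E))).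
apply: (dicksonSM (dicksonSM _ dicksonS_Q0V) dicksonS_Q0V).
apply: dicksonS_bracketM; apply/dvdnP; exists 2%N.
by case: p p_prime => [|[|k]] //= _; rewrite mul2n -addnn addSnnS.
Qed.

Lemma dicksonS_I s : DS (dicksonI p n i s.+1).
Proof.
apply: (dicksonSM _ dicksonS_Q0V).
rewrite -[Q s.+1]scale1r.
exact: (dicksonS_linear 1 (dicksonS_Q _) (dicksonSM dicksonS_BV (dicksonS_A _))).
Qed.

(** * Weight spaces, kernels and images *)

Local Notation W := (weight p n i).

Lemma weightE lam f : W lam f <-> DS f /\ weightvec lam f.
Proof. by split=> -[Sf fE]; split=> //; [exact: subr0_eq | rewrite fE subrr]. Qed.

Lemma partial_eigen_sum f : eigen_sum (F := 'F_p) d f.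
Proof.
exact: (weight_decomposition p_prime (@St_linear p n i) (@StM p n i)
  St_fracX partialopE weight_unit i_gt0).
Qed.

Lemma weightM lam mu f g : W lam f -> W mu g -> W (lam + mu) (f * g).
Proof.
move=> /weightE[Sf fE] /weightE[Sg gE]; apply/weightE; split; first exact: dicksonSM.
exact: (weightvecM (@StM p n i) partialopE fE gE).
Qed.

Lemma weightV lam f : W lam f -> DS f^-1 -> W (- lam) f^-1.
Proof.
move=> /weightE[_ fE] SfV; apply/weightE; split=> //.
exact: (weightvecV (@St_linear p n i) (@StM p n i) partialopE fE).
Qed.

Lemma St_partial f : St f = u * d f.
Proof. by rewrite partialopE; exact: (esym (mulVKf St_unit_neq0 _)). Qed.

Lemma delta_partial f : deltaop p n i f = B * d f.
Proof. exact: (esym (mulVKf B_neq0 _)). Qed.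

Lemma weight0_kernel (c : K) (E : K -> K) : c != 0 -> (forall f, E f = c * d f) ->
  [set f | DS f /\ E f = 0] = W 0.
Proof.
move=> nzc EE; apply/seteqP; split=> f /=.
  case=> Sf; rewrite EE => /(congr1 (fun t => c^-1 * t)).
  by rewrite mulr0 (mulKf nzc) => df0; apply/weightE; rewrite /eigen scale0r.
by move=> /weightE[Sf]; rewrite /eigen scale0r => df0; rewrite EE df0 mulr0.
Qed.

(** Multiplication by the unit [c] shifts weights by [rho], as [image_direct_sum] requires. The
    cases of interest are B with [rho = 0] and [St_unit] with [rho = 1]. *)
Lemma weight_image (c : K) (rho : 'F_p) (E : K -> K) :
    c != 0 -> W rho c -> DS c^-1 -> (forall f, E f = c * d f) ->
  is_direct_sum (I := 'F_p) (fun lam => lam != rho) W (E @` DS).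
Proof.
move=> nzc Wc ScV EE.
apply: (@image_direct_sum 'F_p K d d_linear DS dicksonS0 dicksonS_linear
  dicksonS_partial (fun f _ => partial_eigen_sum f) rho
  (fun f => c * f) (fun f => c^-1 * f) E) => //.
- by move=> a f g; rewrite mulrDr frac_scaleMr.
- by move=> f; exact: (mulVKf nzc).
- by move=> lam f Wf; rewrite addrC; exact: weightM.
- by move=> lam f Wf; rewrite addrC; exact: (weightM (weightV Wc ScV)).
Qed.

End DicksonInvariants.

Theorem theorem2p24 (p n i : nat) (p_prime : prime p) (p_odd : odd p)
    (n_ge1 : (1 <= n)%N) (i_ge1 : (1 <= i)%N) (B_neq0 : dicksonB p n i != 0) :
  let K := {fraction {mpoly 'F_p[n]}} in
  let S : set K := dicksonS p n i in
  let Q0 : K := dicksonQ p n 0 in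
  let B : K := dicksonB p n i in
  let St_i : K -> K := St p n i in
  let delta : K -> K := deltaop p n i in
  let partial : K -> K := partialop p n i in
  let W : 'F_p -> set K := weight p n i in
  let proj : 'F_p -> K -> K := weight_proj p n i in
  (is_derivation_on S partial
     /\ forall f, S f -> iter p partial f = partial f)
  /\ is_direct_sum (I := 'F_p) predT W S
  /\ (forall w : 'F_p -> K, (forall mu, W mu (w mu)) ->
        forall lam, proj lam (\sum_mu w mu) = w lam)
  /\ (forall lam mu f g, W lam f -> W mu g -> W (lam + mu) (f * g))
  /\ [/\ W 1 Q0, W 0 B
       & forall s : nat, (1 <= s < n)%N -> W 0 (dicksonI p n i s)]
  /\ (forall lam f (m : nat), W lam f -> (1 <= m)%N ->
        iter m St_i f =
          (-1) ^+ (m * n) * B ^+ m * Q0 ^+ m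
            * ((\prod_(r < m) (lam + r%:R)) *: f))
  /\ ([set f | S f /\ delta f = 0] = W 0
     /\ is_direct_sum (I := 'F_p) (fun lam => lam != 0) W (delta @` S))
  /\ ([set f | S f /\ St_i f = 0] = W 0
     /\ is_direct_sum (I := 'F_p) (fun lam => lam != 1) W (St_i @` S)).
Proof.
case: n n_ge1 B_neq0 => // m _ B_neq0 K S Q0 B St_i delta partial W proj.
have partialE := @partialopE p m i.
have partial_linear := scaled_der_linear (@St_linear p m.+1 i) partialE.
have unit_neq0 := St_unit_neq0 p_prime B_neq0.
have WB : W 0 B.
  apply/weightE; split; [exact: (dicksonS_B p_prime) | exact: (weight_B m i p_prime)].
have Wunit : W 1 (St_unit p m i).
  apply/weightE; split; [exact: (dicksonS_unit p_prime) | exact: (weight_unit p_prime)].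
have eigen_sums := partial_eigen_sum p_prime i_ge1 B_neq0.
split; [split; first split|].
- exact: (dicksonS_partial p_prime B_neq0).
- by move=> c f g _ _; exact: partial_linear.
- by move=> f g _ _; exact: (scaled_derM (@StM p m.+1 i) partialE).
- move=> f _; have := iter_card_eigen_sum partial_linear (eigen_sums f).
  by rewrite card_Fp.
split.
  exact: (@eigenspace_direct_sum_all 'F_p K partial partial_linear S
    (dicksonS0 p_prime B_neq0) (dicksonS_linear p_prime B_neq0)
    (dicksonS_partial p_prime B_neq0) (fun f _ => eigen_sums f)).
split.
  move=> w wE lam; apply: (lagrange_sum partial_linear) => mu.
  by have /weightE[] := wE mu.
split; first exact: (weightM p_prime B_neq0).
split.
  split; [|exact: WB|].
    by apply/weightE; split; [exact: dicksonS_Q0 | exact: weight_Q0].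
  case=> // s /andP[_ s_lt]; apply/weightE.
  by split; [exact: dicksonS_I | exact: weight_I].
split.
  move=> lam f k /weightE[_ fE] _.
  apply: (etrans (iter_der_weightvec (@St_linear p m.+1 i) (@StM p m.+1 i)
    unit_neq0 partialE (weight_unit p_prime i_ge1 B_neq0) k fE)).
  (* Taken at -1, B and Q_0, this expands the power of [St_unit] into the stated coefficient. *)
  have unitXE (a b c : K) : (a ^+ m.+1 * b * c) ^+ k = a ^+ (k * m.+1) * b ^+ k * c ^+ k.
    by rewrite !exprMn -exprM mulnC.
  exact: (congr1 (fun t => t * _) (unitXE _ _ _)).
split; split.
- exact: (weight0_kernel B_neq0 (delta_partial B_neq0)).
- exact: (weight_image p_prime i_ge1 B_neq0 B_neq0 WB (dicksonS_BV p_prime B_neq0)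
    (delta_partial B_neq0)).
- exact: (weight0_kernel unit_neq0 (St_partial p_prime B_neq0)).
- exact: (weight_image p_prime i_ge1 B_neq0 unit_neq0 Wunit
    (dicksonS_unitV p_prime B_neq0) (St_partial p_prime B_neq0)).
Qed.
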